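(* If a graph $G$ is even and Hamiltonian and a graph $H$ is Hamiltonian-connected, then the exponential graph $G^H$ is Hamiltonian.
   Context: A graph means a finite simple undirected graph with at least one vertex. A graph is even if it has an even number of vertices. A cycle has length at least 3; a Hamiltonian cycle (path) is a cycle (path) containing every vertex. A graph is Hamiltonian if it has a Hamiltonian cycle, and Hamiltonian-connected if for any two distinct vertices there is a Hamiltonian path between them. Exponential graph: for graphs $G$ and $H$ with $V(H)=\{w_1,\ldots,w_q\}$, the exponential graph $G^H$ has vertex set $\{(u_1,\ldots,u_q;w_j) : u_i\in V(G)\ (1\le i\le q),\ 1\le j\le q\}$, and two vertices $(u_1,\ldots,u_q;w_j)$ and $(v_1,\ldots,v_q;w_k)$ are adjacent if and only if either ($j=k$, $u_jv_j\in E(G)$, and $u_i=v_i$ for all $i\ne j$) or ($j\neq k$, $w_jw_k\in E(H)$, and $u_i=v_i$ for all $i$). *)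

(* Defs.v *)
(* MathComp. *)
From HB Require Import structures.
From mathcomp Require Import all_boot.

Set Implicit Arguments.
Unset Strict Implicit.
Unset Printing Implicit Defensive.

Record sgraph := SGraph {
  vertex :> finType;
  adj : rel vertex;
  adj_sym : symmetric adj;
  adj_irrefl : irreflexive adj;
  vertex_gt0 : 0 < #|vertex| }.

Definition even_graph (G : sgraph) : Prop := ~~ odd #|G|.

(* The bound on [size c] is needed: [cycle] closes up sequences of any length,
   so [:: x; y] is a [cycle (@adj G)] as soon as x and y are adjacent. *)
Definition hamiltonian_cycle (G : sgraph) (c : seq G) : Prop :=
  [/\ 3 <= size c, cycle (@adj G) c, uniq c & forall v : G, v \in c].

Definition hamiltonian (G : sgraph) : Prop :=
  exists c : seq G, hamiltonian_cycle c.

(* As in [path], the vertex sequence of the path is x :: p. *)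
Definition hamiltonian_path (G : sgraph) (x y : G) (p : seq G) : Prop :=
  [/\ path (@adj G) x p, last x p = y, uniq (x :: p)
    & forall v : G, v \in x :: p].

Definition hamiltonian_connected (G : sgraph) : Prop :=
  forall x y : G, x <> y -> exists p : seq G, hamiltonian_path x y p.

Section ExponentialGraph.
Variables G H : sgraph.

(* The coordinates u_1, ..., u_q are indexed by the vertices of H themselves,
   so (u_1, ..., u_q; w_j) is the pair (u, w_j) with u w_i = u_i. *)
Definition exp_vertex : finType := ({ffun H -> G} * H)%type.

Definition exp_adj : rel exp_vertex := fun a b =>
  [&& a.2 == b.2, adj (a.1 a.2) (b.1 a.2)
    & [forall i : H, (i != a.2) ==> (a.1 i == b.1 i)]]
  || [&& a.2 != b.2, adj a.2 b.2 & [forall i : H, a.1 i == b.1 i]].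

Lemma exp_adj_sym : symmetric exp_adj.
Proof.
move=> [u j] [v k]; rewrite /exp_adj /=; congr (_ || _).
  rewrite eq_sym; case: eqP => //= ->; rewrite adj_sym; congr (_ && _).
  by apply: eq_forallb => i; rewrite [u i == _]eq_sym.
rewrite eq_sym adj_sym; congr [&& _, _ & _].
by apply: eq_forallb => i; rewrite eq_sym.
Qed.

Lemma exp_adj_irrefl : irreflexive exp_adj.
Proof. by move=> [u j]; rewrite /exp_adj /= eqxx adj_irrefl. Qed.

Lemma exp_vertex_gt0 : 0 < #|exp_vertex|.
Proof. by rewrite card_prod card_ffun muln_gt0 expn_gt0 !vertex_gt0. Qed.

Definition exp_graph : sgraph :=
  SGraph exp_adj_sym exp_adj_irrefl exp_vertex_gt0.

End ExponentialGraph.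

(* Main.v *)
(** Contracting every copy of H turns G^H into the Cartesian power of G, whose
    edges are labelled by the coordinate they change.  It suffices to find a
    Hamiltonian cycle of that power in which consecutive edges carry different
    labels: each of its vertices is then replaced by a Hamiltonian path of H
    joining the two labels.  Given a Hamiltonian cycle F of even length N of the
    power on all coordinates but k, and one g of even length n of G, the torus
    C_N x C_n has a Hamiltonian cycle alternating F-steps and g-steps: always
    move forward along g, and back and forth along F, except that one of these
    moves back is replaced by a move forward in each turn around g, so that a
    turn advances F by 2 in total.  The same construction, iterated, provides F. *)
Require Import Defs.
From HB Require Import structures.
From mathcomp Require Import all_boot zify.

Set Implicit Arguments.
Unset Strict Implicit.
Unset Printing Implicit Defensive.

(** * Closed walks as periodic sequences *)

Lemma periodic_addM T (f : nat -> T) n :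
  (forall i, f (i + n) = f i) -> forall k i, f (i + k * n) = f i.
Proof.
move=> fn; elim=> [|k IHk] i; first by rewrite mul0n addn0.
by rewrite mulSn addnCA addnC fn IHk.
Qed.

Lemma periodic_modn T (f : nat -> T) n :
  (forall i, f (i + n) = f i) -> forall i, f (i %% n) = f i.
Proof. by move=> fn i; rewrite {2}(divn_eq i n) addnC periodic_addM. Qed.

Lemma periodic_cycle T (e : rel T) (f : nat -> T) n :
  (forall i, e (f i) (f i.+1)) -> (forall i, f (i + n) = f i) ->
  cycle e (map f (iota 0 n)).
Proof.
case: n => [//|n] fe fn.
have fpath m i : path e (f i) (map f (iota i.+1 m)).
  by elim: m i => //= m IHm i; rewrite fe IHm.
by rewrite /= -[X in rcons _ X]fn -map_rcons -cats1 -(iotaD 1 n 1) fpath.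
Qed.

Lemma hamiltonian_cycle_size (G : sgraph) (c : seq G) :
  hamiltonian_cycle c -> size c = #|G|.
Proof.
by case=> _ _ /card_uniqP <- cG; apply: eq_card => x; rewrite cG.
Qed.

(** Indexing by all of [nat] lets later walks run around the cycle many times without wraparound. *)
Lemma hamiltonian_cycle_periodic (G : sgraph) (c : seq G) :
  hamiltonian_cycle c ->
  exists g : nat -> G,
    [/\ forall i, g (i + #|G|) = g i, forall i, adj (g i) (g i.+1)
      & forall x, exists i, g i = x].
Proof.
move=> Hc; have sc := hamiltonian_cycle_size Hc.
case: Hc => c3 cc cu cG; case: c => [//|x0 p] in c3 cc cu cG sc *.
exists (fun i => nth x0 (x0 :: p) (i %% #|G|)); split.
- by move=> i; rewrite modnDr.
- move=> i; rewrite -addn1 -modnDml addn1.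
  have: i %% #|G| < #|G| by rewrite ltn_mod -sc.
  move: (i %% #|G|) => {}i; rewrite -sc => lti.
  have /(pathP x0)/(_ i) := cc; rewrite size_rcons => /(_ lti).
  rewrite -rcons_cons !nth_rcons lti /=.
  move: lti; rewrite /= ltnS leq_eqVlt => /predU1P[->|lti].
    by rewrite ltnn eqxx modnn.
  by rewrite lti modn_small.
- move=> x; exists (index x (x0 :: p)).
  by rewrite modn_small ?nth_index // -sc index_mem.
Qed.

(** * Walks in the Cartesian power of [G], with labelled steps *)

Section GrayCode.
Variables G H : sgraph.
Implicit Types (u v : {ffun H -> G}) (k : H) (s : seq H).

Definition step k u v :=
  adj (u k) (v k) && [forall i, (i != k) ==> (u i == v i)].

Lemma stepP k u v :
  reflect (adj (u k) (v k) /\ forall i, i != k -> u i = v i) (step k u v).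
Proof.
apply: (iffP andP) => -[uv eq_uv]; split=> //.
  by move=> i ik; apply/eqP; have /forallP/(_ i)/implyP := eq_uv; apply.
by apply/forallP => i; apply/implyP => ik; rewrite eq_uv.
Qed.

Lemma step_sym k u v : step k u v = step k v u.
Proof.
rewrite /step adj_sym; congr andb.
by apply: eq_forallb => i; rewrite [u i == _]eq_sym.
Qed.

Definition update u k (x : G) : {ffun H -> G} :=
  [ffun i => if i == k then x else u i].

Lemma step_update k u (x y : G) :
  adj x y -> step k (update u k x) (update u k y).
Proof.
move=> xy; apply/stepP; rewrite !ffunE eqxx; split=> // i ik.
by rewrite !ffunE (negPf ik).
Qed.

Lemma step_update_neq k j u v (x : G) :
  j != k -> step j u v -> step j (update u k x) (update v k x).
Proof.
move=> jk /stepP[uv eq_uv]; apply/stepP; rewrite !ffunE (negPf jk).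
by split=> // i ij; rewrite !ffunE eq_uv.
Qed.

(* A closed walk of length N, as an N-periodic sequence, whose i-th step changes
   coordinate D i and which realizes every assignment of the coordinates in s.
   It has no repetition when N = #|G| ^ size s. *)
Definition gray_code s N (F : nat -> {ffun H -> G}) (D : nat -> H) :=
  [/\ forall i, F (i + N) = F i, forall i, D i \in s,
      forall i, step (D i) (F i) (F i.+1)
    & forall u, exists i, {in s, F i =1 u}].

Variables (g : nat -> G) (n : nat).
Hypotheses (n_gt0 : 0 < n) (n_even : ~~ odd n).
Hypothesis g_periodic : forall i, g (i + n) = g i.
Hypothesis g_adj : forall i, adj (g i) (g i.+1).
Hypothesis g_surj : forall x, exists i, g i = x.

Lemma gray_code1 k :
  gray_code [:: k] n (fun i => update [ffun=> g 0] k (g i)) (fun=> k).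
Proof.
split=> [i|i|i|u]; rewrite ?g_periodic ?mem_head ?step_update //.
have [i gi] := g_surj (u k); exists i => j; rewrite inE => /eqP->.
by rewrite ffunE eqxx.
Qed.

(* The position along F after t moves along F. *)
Definition zigzag t := (t %/ n).*2 + odd t.

(** Within a block of [n] moves the position alternates between two values; as [n] is even, the
    block ends at the larger one and the next move goes forward. *)
Lemma zigzagS t :
  zigzag t.+1 = (zigzag t).+1 \/ zigzag t = (zigzag t.+1).+1.
Proof.
have := divn_eq t n; have := ltn_pmod t n_gt0; rewrite /zigzag.
set a := t %/ n; set b := t %% n => ltb ->.
have oab c : odd (a * n + c) = odd c.
  by rewrite oddD oddM (negPf n_even) andbF.
move: (ltb); rewrite leq_eqVlt => /predU1P[bn|ltb1]; last first.
  rewrite -addnS !oab divnMDl // (divn_small ltb1) /=.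
  case: (odd b); lia.
left; rewrite -addnS !oab bn divnMDl // divnn n_gt0.
have := n_even; rewrite -bn /=; case: (odd b) => //=; lia.
Qed.

Lemma zigzagD a b : zigzag (a * n + b) = a.*2 + zigzag b.
Proof.
rewrite /zigzag divnMDl // oddD oddM (negPf n_even) andbF doubleD /=; lia.
Qed.

(** Moves along [F] and [g] alternate, [F] first. *)
Definition torus_walk k (F : nat -> {ffun H -> G}) t :=
  update (F (zigzag (uphalf t))) k (g t./2).

(** [D j] labels the edge between [F j] and [F j.+1] whichever way it is crossed, hence the
    minimum. *)
Definition torus_dir k (D : nat -> H) t :=
  if odd t then k else D (minn (zigzag t./2) (zigzag t./2.+1)).

(** A turn around [g] takes [2 * n] steps and advances [F] by 2, so [N./2] turns close the walk. *)
Lemma gray_code_torus k s N F D :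
  0 < N -> ~~ odd N -> k \notin s -> gray_code s N F D ->
  gray_code (k :: s) (n * N) (torus_walk k F) (torus_dir k D).
Proof.
move=> N_gt0 N_even ks [FN Ds Fstep Fcover].
have NE : N = N./2.*2 by have := odd_double_half N; rewrite (negPf N_even).
have nN : n * N = (N./2 * n).*2 by rewrite {1}NE; lia.
have pT i : torus_walk k F (i + n * N) = torus_walk k F i.
  rewrite /torus_walk nN !uphalfE -addSn !halfD odd_double !andbF !add0n doubleK.
  by rewrite (periodic_addM g_periodic) addnC zigzagD -NE addnC FN.
split=> // [i|i|u].
- by rewrite /torus_dir; case: ifP; rewrite inE ?eqxx // Ds orbT.
- rewrite /torus_walk /torus_dir; case: ifP => oi.
    by rewrite /= !uphalf_half oi /= !add1n step_update.
  rewrite /= !uphalf_half oi /= add0n.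
  have Dk j : D j != k by apply: contraNneq ks => <-.
  apply: step_update_neq => //.
  case: (zigzagS i./2) => E; rewrite E.
    by rewrite (minn_idPl (leqnSn _)).
  by rewrite (minn_idPr (leqnSn _)) step_sym.
- have [j Fj] := Fcover u; have [i gi] := g_surj (u k).
  suff [t [Ft gt]] : exists t,
      F (zigzag (uphalf t)) = F j /\ g t./2 = g i.
    exists t => l; rewrite inE /torus_walk ffunE; case: eqP => [->|_] /=.
      by rewrite gt.
    by rewrite Ft; apply: Fj.
  (* Even times reach the pairs of positions of equal parity, odd times the others. *)
  have [ij|ij] := eqVneq (odd i) (odd j).
    exists (j./2 * n + i %% n).*2; rewrite uphalf_double doubleK.
    split; last by rewrite addnC (periodic_addM g_periodic) periodic_modn.
    rewrite zigzagD /zigzag divn_small ?ltn_pmod // odd_mod ?(negPf n_even) //.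
    by rewrite ij addnC odd_double_half.
  (* At this odd time there is one more move along [F] than along [g]. Adding [N] to [j] keeps the
     number of moves along [F] positive, so that its predecessor is meaningful. *)
  exists (((j + N)./2 * n + i.+1 %% n).-1.*2.+1).
  have jN : 0 < (j + N)./2 by lia.
  have pos : 0 < (j + N)./2 * n + i.+1 %% n by rewrite addn_gt0 muln_gt0 jN n_gt0.
  have oj : odd (j + N) = odd j by rewrite oddD (negPf N_even) addbF.
  rewrite /= uphalf_double doubleK prednK //; split.
    rewrite zigzagD /zigzag divn_small ?ltn_pmod // odd_mod ?(negPf n_even) //=.
    have -> : ~~ odd i = odd (j + N) by rewrite oj; case: (odd i) (odd j) ij => [] [].
    by rewrite addnC odd_double_half FN.
  have gS a b : a = b %[mod n] -> g a = g b.
    by move=> ab; rewrite -(periodic_modn g_periodic) ab periodic_modn.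
  apply: gS; apply/eqP; rewrite -(eqn_modDr 1) !addn1 prednK //.
  by rewrite modnMDl modn_mod.
Qed.

Lemma gray_code_exists k s :
  uniq (k :: s) -> exists F D, gray_code (k :: s) (n ^ size (k :: s)) F D.
Proof.
elim: s k => [|l s IHs] k.
  by exists (fun i => update [ffun=> g 0] k (g i)), (fun=> k); apply: gray_code1.
case/andP=> ks /IHs[F [D FD]].
exists (torus_walk k F), (torus_dir k D); rewrite expnS.
by apply: gray_code_torus; rewrite ?expn_gt0 ?n_gt0 // oddX negb_or.
Qed.

End GrayCode.

(** * Replacing vertices by Hamiltonian paths of [H] *)

Section BlowUp.
Variables G H : sgraph.
Hypothesis H_connected : hamiltonian_connected H.
Local Notation e := (@exp_adj G H).

Lemma exp_adj_step k (u v : {ffun H -> G}) : e (u, k) (v, k) = step k u v.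
Proof. by rewrite /exp_adj /step /= eqxx orbF. Qed.

Lemma exp_adj_copy (u : {ffun H -> G}) a b : adj a b -> e (u, a) (u, b).
Proof.
move=> ab; apply/orP; right; rewrite /= ab andTb; apply/andP; split.
  by apply: contraTneq ab => ->; rewrite adj_irrefl.
by apply/forallP => i.
Qed.

Lemma hamiltonian_path_copy (u v : {ffun H -> G}) a b :
  a != b -> step b u v ->
  exists p, [/\ path e (u, a) (rcons p (v, b)), (size p).+1 = #|H|
              & forall w, (u, w) \in (u, a) :: p].
Proof.
move=> /eqP/H_connected[p [pp lp /card_uniqP up pH]] uv.
exists [seq (u, x) | x <- p]; split.
- rewrite rcons_path last_map lp exp_adj_step uv andbT.
  by rewrite path_map; apply: sub_path pp => x y; apply: exp_adj_copy.
- by rewrite size_map -[LHS]up; apply: eq_card => x; rewrite pH.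
- by move=> w; rewrite -(map_cons (pair u)) map_f.
Qed.

(** The copy of [H] at [F t] is entered at [d t] and left at [d t.+1], the coordinate that the next
    step changes. *)
Lemma blow_up_walk (F : nat -> {ffun H -> G}) (d : nat -> H) :
  (forall t, d t != d t.+1) -> (forall t, step (d t.+1) (F t) (F t.+1)) ->
  forall m, exists p,
    [/\ path e (F 0, d 0) (rcons p (F m.+1, d m.+1)),
        (size p).+1 = m.+1 * #|H|
      & forall t w, t <= m -> (F t, w) \in (F 0, d 0) :: p].
Proof.
move=> dneq Fstep; elim=> [|m [p [pp sp cp]]].
  have [p [pp sp cp]] := hamiltonian_path_copy (dneq 0) (Fstep 0).
  exists p; split=> //; first by rewrite mul1n.
  by move=> t w; rewrite leqn0 => /eqP->.
have [p' [pp' sp' cp']] := hamiltonian_path_copy (dneq m.+1) (Fstep m.+1).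
exists (rcons p (F m.+1, d m.+1) ++ p'); split.
- by rewrite rcons_cat cat_path pp last_rcons.
- by rewrite size_cat size_rcons mulSn -sp -sp' [in RHS]addnC addnS.
- move=> t w; rewrite cat_rcons -cat_cons mem_cat leq_eqVlt => /predU1P[->|].
    by rewrite cp' orbT.
  by move=> tm; rewrite cp.
Qed.

End BlowUp.

(** Counting replaces a direct proof of uniqueness: a covering sequence with no more entries than
    vertices has no repetition. *)
Lemma hamiltonian_of_cover (G : sgraph) (c : seq G) :
  2 < size c -> cycle (@adj G) c -> (forall v, v \in c) -> size c <= #|G| ->
  hamiltonian G.
Proof.
move=> c3 cc cG sc; exists c; split=> //.
apply/card_uniqP/eqP; rewrite eqn_leq card_size (leq_trans sc) //.
by apply: subset_leq_card; apply/subsetP => x _; apply: cG.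
Qed.

Theorem theorem8 (G H : sgraph) :
  even_graph G -> hamiltonian G -> hamiltonian_connected H ->
  hamiltonian (exp_graph G H).
Proof.
move=> G_even [c cG] H_conn.
have G_gt2 : 2 < #|G| by rewrite -(hamiltonian_cycle_size cG); case: cG.
have [g [g_per g_adj g_surj]] := hamiltonian_cycle_periodic cG.
have G_gt0 := vertex_gt0 G.
have card_exp : #|exp_graph G H| = #|G| ^ #|H| * #|H|.
  by rewrite card_prod card_ffun.
have := enum_uniq H; have inH := mem_enum H; have sH := cardE H.
case: (enum H) => [|k s] in inH sH *; first by have := vertex_gt0 H; rewrite sH.
have cover (F : nat -> {ffun H -> G}) :
    (forall u : {ffun H -> G}, exists i, {in k :: s, F i =1 u}) ->
    forall u, exists i, F i = u.
  move=> FH u; have [i Fi] := FH u; exists i.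
  by apply/ffunP => x; apply: Fi; rewrite inH.
(* If [H] has a single vertex, labels cannot alternate, but the exponential graph is a copy of
   [G]. *)
case: s => [|l s] in inH sH cover *.
  move=> _; pose F i : {ffun H -> G} := update [ffun=> g 0] k (g i).
  have [F_per _ F_step /cover F_cover] : gray_code [:: k] #|G| F (fun=> k).
    exact: gray_code1.
  pose f i : exp_graph G H := (F i, k).
  have f_adj i : adj (f i) (f i.+1) by rewrite [adj _ _]exp_adj_step F_step.
  apply: (@hamiltonian_of_cover _ (map f (iota 0 #|G|))).
  - by rewrite size_map size_iota.
  - by apply: periodic_cycle f_adj _ => i; rewrite /f F_per.
  - move=> [u w]; have [i Fi] := F_cover u.
    have := inH w; rewrite inE => /eqP->.
    apply/mapP; exists (i %% #|G|); first by rewrite mem_iota ltn_pmod.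
    by rewrite /f periodic_modn // Fi.
  - by rewrite card_exp size_map size_iota sH muln1.
case/andP=> ks us.
have [F [D FD]] := gray_code_exists G_gt0 G_even g_per g_adj g_surj us.
have n_even : ~~ odd (#|G| ^ size (l :: s)) by rewrite oddX negb_or.
have n_gt0 : 0 < #|G| ^ size (l :: s) by rewrite expn_gt0 G_gt0.
(* [gray_code] does not record that labels alternate, so the last torus is formed explicitly: steps
   at odd times change [k], the others a coordinate in [l :: s]. *)
have [] := gray_code_torus G_gt0 G_even g_per g_adj g_surj n_gt0 n_even ks FD.
have Ds t : D t \in l :: s by case: FD.
rewrite -expnS -[_.+1]/(size [:: k, l & s]) -sH; set N := #|G| ^ _.
set T := torus_walk _ _ _ _; set E := torus_dir _ _ _ => T_per _ T_step /cover T_cover.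
(* This is [E] delayed by one step; the initial value [k] is the label of the closing step, since
   [N] is even. *)
pose d t := if odd t then E t.-1 else k.
have dneq t : d t != d t.+1.
  rewrite /d /= /E /torus_dir; case: t => [|t] /=.
    by apply: contraNneq ks => ->.
  by case: (odd t) => /=; [|rewrite eq_sym]; apply: contraNneq ks => ->.
have dstep t : step (d t.+1) (T t) (T t.+1).
  have := T_step t; rewrite /d /E /torus_dir /=.
  by case: ifP.
have N_gt0 : 0 < N by rewrite expn_gt0 G_gt0.
have N_even : ~~ odd N by rewrite /N oddX negb_or sH.
have [p [pp sp cp]] := blow_up_walk H_conn dneq dstep N.-1.
rewrite prednK // in pp sp.
apply: (@hamiltonian_of_cover (exp_graph G H) ((T 0, d 0) :: p)).
- rewrite /= sp sH; apply: leq_trans (leq_pmulr _ _) => //.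
  by apply: leq_trans G_gt2 _; rewrite /N sH expnS leq_pmulr // expn_gt0 G_gt0.
- have TN : T N = T 0 by rewrite -[N]add0n T_per.
  have dN : d N = d 0 by rewrite /d (negPf N_even).
  by rewrite TN dN in pp.
- move=> [u w]; have [i Ti] := T_cover u.
  rewrite -Ti -(periodic_modn T_per); apply: cp.
  by rewrite -ltnS prednK // ltn_pmod.
- by rewrite card_exp /= sp.
Qed.
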